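(* Let $U$ satisfy A1 and A2 with constants $0<\alpha\le\beta_U$, let $\phi^*(t)=\arg\max_rU(t,r)$, and fix a deterministic $K$-partition $c:\mathcal{T}\to\{1,\dots,K\}$. For a decoder $\hat\phi:\{1,\dots,K\}\to\mathbb{R}^r$ put $\varepsilon(\hat\phi)=\mathbb{E}\bigl[\|\phi^*(t)-\hat\phi(c(t))\|^2\bigr]$ and let the welfare loss be $\Delta(\hat\phi)=\mathbb{E}\bigl[U(t,\phi^*(t))-U(t,\hat\phi(c(t)))\bigr]$. Let $\phi(k)=\mathbb{E}[\phi^*(t)\mid c(t)=k]$ be the conditional mean. (a) $\phi$ minimises $\varepsilon(\hat\phi)$ among all decoders $\hat\phi:\{1,\dots,K\}\to\mathbb{R}^r$. (b) If the utility is isotropic quadratic ($\alpha=\beta_U$, equivalently $\nabla^2_{rr}U=-\alpha I$), then $\phi$ minimises the exact welfare loss $\Delta(\hat\phi)$ among all decoders, and the bounds $\frac{\alpha}{2}\varepsilon(\phi)\le\Delta(\phi)\le\frac{\beta_U}{2}\varepsilon(\phi)$ hold with equality. (c) If $U(t,r)=-\tfrac12(r-\phi^*(t))^{\top}W(r-\phi^*(t))$ with a constant positive-definite matrix $W$, then $\phi$ also minimises the exact welfare loss $\Delta(\hat\phi)$ among all decoders (although $\alpha$ and $\beta_U$ need not coincide). (d) If instead $U(t,r)=-\tfrac12(r-\phi^*(t))^{\top}W(t)(r-\phi^*(t))$ with a positive-definite weight $W(t)$ varying with $t$ (or with the cell), then the exact welfare-loss-minimising decoder is the weighted conditional mean $$\hat\phi_W(k)=\bigl(\mathbb{E}[W(t)\mid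 c(t)=k]\bigr)^{-1}\,\mathbb{E}[W(t)\phi^*(t)\mid c(t)=k],$$ while the ordinary conditional mean $\phi$ still minimises $\varepsilon(\hat\phi)$.
   Context: Types $t$ take values in $\mathcal{T}\subseteq\mathbb{R}^d$ with distribution $F$; all expectations are over $t\sim F$. The utility $U:\mathcal{T}\times\mathbb{R}^r\to\mathbb{R}$ is measurable and twice continuously differentiable in its second argument, and satisfies A1: $\nabla^2_{rr}U(t,r)\succeq-\beta_U I$ for all $(t,r)$, with $\beta_U>0$; A2: $\nabla^2_{rr}U(t,r)\preceq-\alpha I$ for all $(t,r)$, with $0<\alpha\le\beta_U$. The action space $\mathbb{R}^r$ is unconstrained, so $\nabla_rU(t,\phi^*(t))=0$. A deterministic $K$-partition is a measurable map $c:\mathcal{T}\to\{1,\dots,K\}$. The map $\phi^*$ is measurable and integrable so that the conditional means exist; values of decoders on categories of probability zero are irrelevant. Expectations of nonnegative quantities are allowed to be $+\infty$. In (d), $W(\cdot)$ is measurable and, by A1 and A2, satisfies $\alpha I\preceq W(t)\preceq\beta_UI$. *)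

(* Defs.v *)
From HB Require Import structures.
From mathcomp Require Import all_boot all_order all_algebra.
From mathcomp Require Import all_classical all_reals all_analysis.

Set Implicit Arguments.
Unset Strict Implicit.
Unset Printing Implicit Defensive.

Import Order.TTheory GRing.Theory Num.Theory.
Import numFieldNormedType.Exports.

Local Open Scope classical_set_scope.
Local Open Scope ring_scope.

(* A subset A of a measurable space, with the trace sigma-algebra. The base
   point a : A only witnesses that A is nonempty: measurable types of the
   library are pointed. *)
Definition pointed_subset (X : choiceType) (A : set X) (a : A) : Type := A.

HB.instance Definition _ (X : choiceType) (A : set X) (a : A) :=
  Choice.on (pointed_subset a).
HB.instance Definition _ (X : choiceType) (A : set X) (a : A) :=
  isPointed.Build (pointed_subset a) a.

Definition trace_space (disp : measure_display) (X : measurableType disp)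
    (A : set X) (a : A) : Type :=
  g_sigma_algebra_preimageType (fun x : pointed_subset a => \val x : X).

HB.instance Definition _ (disp : measure_display) (X : measurableType disp)
  (A : set X) (a : A) := Measurable.on (trace_space a).

Section matrices.
Context {R : realType}.

(* The library puts the Borel sigma-algebra of R^n on tuples, not on matrices. *)
Definition col_of_tuple (n : nat) (x : n.-tuple R) : 'cV[R]_n :=
  \col_i tnth x i.

(* The square of the Euclidean norm; the library norm on matrices is the
   sup norm. *)
Definition sqnorm (n : nat) (v : 'cV[R]_n) : R := \sum_i v i 0 ^+ 2.

Definition qform (n : nat) (A : 'M[R]_n) (v : 'cV[R]_n) : R :=
  (v^T *m A *m v) 0 0.

(* Definiteness includes symmetry; for the Hessian of a C^2 function this part
   is automatic. *)
Definition psdmx (n : nat) (A : 'M[R]_n) : Prop :=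
  A^T = A /\ forall v, 0 <= qform A v.

Definition posdefmx (n : nat) (A : 'M[R]_n) : Prop :=
  A^T = A /\ forall v, v != 0 -> 0 < qform A v.

Definition loewner_le (n : nat) (A B : 'M[R]_n) : Prop := psdmx (B - A).

End matrices.

Section calculus.
Context {R : realType} {n : nat}.
Implicit Types (f : 'cV[R]_n -> R) (x : 'cV[R]_n).

Definition partial f (i : 'I_n) : 'cV[R]_n -> R :=
  fun x => 'D_(delta_mx i 0) f x.

Definition hessian f x : 'M[R]_n :=
  \matrix_(i, j) partial (partial f i) j x.

Definition cont_diff1 f : Prop :=
  forall i, (forall x, derivable f x (delta_mx i 0)) /\
            continuous (partial f i).

Definition cont_diff2 f : Prop :=
  cont_diff1 f /\ forall i, cont_diff1 (partial f i).

End calculus.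

Section decoders.
Context {R : realType} {disp : measure_display} {T : measurableType disp}.
Variable F : probability T R.

(* E[X | B] = E[X 1_B] / F(B), entrywise; a junk value when F(B) = 0. *)
Definition cond_mean (m n : nat) (X : T -> 'M[R]_(m, n)) (B : set T) :
    'M[R]_(m, n) :=
  \matrix_(i, j) ((\int[F]_(t in B) X t i j) / fine (F B)).

Context {r K : nat}.
Implicit Types (c : T -> 'I_K) (phistar : T -> 'cV[R]_r)
  (g : 'I_K -> 'cV[R]_r).

Definition cell c (k : 'I_K) : set T := c @^-1` [set k].

Definition decoding_error phistar c g : \bar R :=
  'E_F[fun t => sqnorm (phistar t - g (c t))].

Definition welfare_loss (U : T -> 'cV[R]_r -> R) phistar c g : \bar R :=
  'E_F[fun t => U t (phistar t) - U t (g (c t))].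

Definition minimises (L : ('I_K -> 'cV[R]_r) -> \bar R) g : Prop :=
  forall h, (L g <= L h)%E.

End decoders.

(* Main.v *)
(* With W(t) the weight of the quadratic loss (W = I for the decoding error)
   and p a decoder solving the normal equations E[W (phi* - p(k)) | c = k] = 0,
   the cross term of the expansion of the loss of g around p is integrable with
   zero mean, so that
     E |g(c) - phi*|_W^2 = E |p(c) - phi*|_W^2 + E |g(c) - p(c)|_W^2
   even when the losses are infinite. Minimality of p follows, and W >= alpha I
   makes the last term positive as soon as g differs from p on a cell of
   positive probability. In the isotropic case, the second partial derivatives
   of U(t, x) + alpha / 2 |x - phi*(t)|^2 in x vanish and its gradient is zero
   at the maximiser phi*(t), so that this function of x is constant. *)

Require Import Defs.
From mathcomp Require Import all_boot all_order all_algebra.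
From mathcomp Require Import all_classical all_reals all_analysis.
From mathcomp Require Import measurable_realfun ring lra.

Import Order.TTheory GRing.Theory Num.Theory.
Import numFieldNormedType.Exports.

Local Open Scope classical_set_scope.
Local Open Scope ring_scope.

(** * Quadratic forms of real matrices: expansion, polarisation, invertibility *)

Section quadratic_forms.
Context {R : realType} {n : nat}.
Implicit Types (A B W : 'M[R]_n) (u v x p : 'cV[R]_n).

Lemma qformE A v : qform A v = (v^T *m (A *m v)) 0 0.
Proof. by rewrite /qform mulmxA. Qed.

(** Symmetry makes the two cross terms transposes of each other, so they merge into one with factor
    2. Every later expansion of a square rests on this. *)
Lemma qformD A u v : A^T = A ->
  qform A (u + v) = qform A u + qform A v + 2 * (u^T *m (A *m v)) 0 0.
Proof.
move=> Asym.
have sw : (v^T *m (A *m u)) 0 0 = (u^T *m (A *m v)) 0 0.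
  transitivity (trmx (v^T *m (A *m u)) 0 0); first by rewrite [RHS]mxE.
  by rewrite !trmx_mul trmxK Asym mulmxA.
rewrite !qformE [(u + v)^T]linearD /= mulmxDr mulmxDl !mulmxDr.
rewrite ![(_ + _ : 'M[_]_1) 0 0]mxE sw; lra.
Qed.

Lemma qformBl A B v : qform (A - B) v = qform A v - qform B v.
Proof. by rewrite /qform mulmxBr mulmxBl !mxE. Qed.

Lemma qformNl A v : qform (- A) v = - qform A v.
Proof. by rewrite /qform mulmxN mulNmx !mxE. Qed.

Lemma qformN A v : qform A (- v) = qform A v.
Proof. by rewrite /qform [(- v)^T]linearN /= !mulNmx mulmxN opprK. Qed.

Lemma qform0 A : qform A 0 = 0.
Proof. by rewrite /qform mulmx0 mxE. Qed.

Lemma qformZ A (a : R) v : qform A (a *: v) = a ^+ 2 * qform A v.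
Proof.
by rewrite /qform [(a *: v)^T]linearZ /= -!scalemxAl -scalemxAr !mxE mulrA.
Qed.

Lemma qform_scalar (a : R) v : qform a%:M v = a * sqnorm v.
Proof.
rewrite qformE mul_scalar_mx -scalemxAr !mxE; congr (_ * _).
by apply: eq_bigr => i _; rewrite mxE expr2.
Qed.

Lemma delta_mul_mx i u : ((delta_mx i 0 : 'cV_n)^T *m u) 0 0 = u i 0.
Proof. by rewrite trmx_delta -rowE mxE. Qed.

Lemma mul_mx_delta A i j : (A *m (delta_mx j 0 : 'cV_n)) i 0 = A i j.
Proof. by rewrite -colE mxE. Qed.

Lemma qform_delta A i : qform A (delta_mx i 0) = A i i.
Proof. by rewrite qformE delta_mul_mx mul_mx_delta. Qed.

Lemma sqnorm_ge0 v : 0 <= sqnorm v.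
Proof. by apply: sumr_ge0 => i _; exact: sqr_ge0. Qed.

Lemma sqnorm_eq0 v : sqnorm v = 0 -> v = 0.
Proof.
move=> v0; apply/colP => i; rewrite mxE; apply/eqP; rewrite -sqrf_eq0.
have /eqP := v0; rewrite /sqnorm psumr_eq0; last by move=> j _; exact: sqr_ge0.
by move=> /allP/(_ i); rewrite mem_index_enum => /(_ isT).
Qed.

Lemma sqnormN v : sqnorm (- v) = sqnorm v.
Proof. by apply: eq_bigr => i _; rewrite mxE sqrrN. Qed.

(** Expanding the form at the sum of two basis vectors isolates twice the entry [A i j]. *)
Lemma qform_eq0 A : A^T = A -> (forall v, qform A v = 0) -> A = 0.
Proof.
move=> Asym A0; apply/matrixP => i j; rewrite mxE.
have := qformD A (delta_mx i 0) (delta_mx j 0) Asym.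
rewrite !A0 delta_mul_mx mul_mx_delta; lra.
Qed.

(* Polarisation at [e_i + e_j] and [e_i - e_j]. *)
Lemma psdmx_entry_le A (b : R) : psdmx A -> (forall i, A i i <= b) ->
  forall i j, `|A i j| <= b.
Proof.
move=> [Asym A0] Ab i j.
have := A0 (delta_mx i 0 + delta_mx j 0).
have := A0 (delta_mx i 0 + - delta_mx j 0).
rewrite !qformD // qformN !qform_delta mulmxN mulmxN [(- _ : 'M[_]_1) 0 0]mxE.
rewrite delta_mul_mx mul_mx_delta.
have := Ab i; have := Ab j => *; rewrite ler_norml; apply/andP; split; lra.
Qed.

Lemma posdef_psdmx A : posdefmx A -> psdmx A.
Proof.
move=> [Asym A0]; split => // v.
have [->|v0] := eqVneq v 0; first by rewrite qform0.
exact/ltW/A0.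
Qed.

(** A nonzero row of the left kernel of [A^T] transposes to a nonzero vector [v] with [A *m v = 0],
    where the form would vanish. *)
Lemma posdef_unitmx A : (forall v, v != 0 -> 0 < qform A v) -> A \in unitmx.
Proof.
move=> A0; rewrite -unitmx_tr -row_free_unit -kermx_eq0.
apply/eqP/row_matrixP => i.
rewrite row0; apply/eqP; apply: contraT => ri0.
have /A0 : (row i (kermx A^T))^T != 0.
  by apply: contra ri0 => /eqP/(congr1 trmx); rewrite trmxK trmx0 => ->.
rewrite qformE -[A *m _]trmxK trmx_mul trmxK.
have -> : row i (kermx A^T) *m A^T = 0 by apply/sub_kermxP; exact: row_sub.
by rewrite trmx0 mulmx0 mxE ltxx.
Qed.

End quadratic_forms.

(** * Directional derivatives, critical points and functions with constant Hessian *)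

Section calculus_facts.
Context {R : realType} {n : nat}.
Implicit Types (f : 'cV[R]_n -> R) (x p v : 'cV[R]_n).

(** The difference quotient is exactly [a + h * b] for nonzero [h]. Differentiating a polynomial of
    degree at most two thus reduces to an algebraic expansion along a line. *)
Lemma is_derive_quadratic f x v (a b : R) :
  (forall h, f (h *: v + x) = f x + h * a + h ^+ 2 * b) -> is_derive x v f a.
Proof.
move=> fh.
have cv : h^-1 *: ((f \o shift x) (h *: v) - f x) @[h --> (0:R)^'] --> a.
  apply: (@cvg_trans _ ((a + h * b) @[h --> (0:R)^'])).
    apply: near_eq_cvg; near=> h => /=.
    have h0 : h != 0 by near: h; exact: nbhs_dnbhs_neq.
    by rewrite fh /GRing.scale /=; field.
  apply: cvg_within_filter.
  have : (a + h * b) @[h --> (0:R)] --> a + 0 * b.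
    by apply: cvgD; [exact: cvg_cst|apply: cvgMl; exact: cvg_id].
  by rewrite mul0r addr0.
apply: DeriveDef; last exact: cvg_lim cv.
by apply/cvg_ex; exists a.
Unshelve. all: by end_near. Qed.

Lemma derive_quadratic f x v (a b : R) :
  (forall h, f (h *: v + x) = f x + h * a + h ^+ 2 * b) -> 'D_v f x = a.
Proof. by move=> /is_derive_quadratic ?; exact: derive_val. Qed.

(** In (d) this turns the curvature bounds A1 and A2 into bounds on the weight [W t] itself. *)
Lemma hessian_quadratic (W : 'M[R]_n) p x : W^T = W ->
  hessian (fun y => - (1 / 2) * qform W (y - p)) x = - W.
Proof.
move=> Wsym; set f := (fun y => _).
have Df i : partial f i = fun y => - (W *m (y - p)) i 0.
  apply/funext => y; 
  apply: (@derive_quadratic _ _ _ _ (- (1 / 2) * W i i)) => h.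
  rewrite /f -[_ *: _ + _ - p]addrA (qformD _ (_ *: _)) //.
  rewrite qformZ qform_delta [(h *: _)^T]linearZ /= -scalemxAl.
  by rewrite [(_ *: _ : 'M[_]_1) 0 0]mxE delta_mul_mx; field.
apply/matrixP => i j; rewrite !mxE Df; 
apply: (@derive_quadratic _ _ _ _ 0) => h.
rewrite -[_ *: _ + _ - p]addrA mulmxDr -scalemxAr [(_ + _ : 'cV[_]__) i 0]mxE.
by rewrite [(_ *: _ : 'cV[_]__) i 0]mxE mul_mx_delta; ring.
Qed.

(** Both difference quotients are the same function of [h]; this gives access to the one-variable
    theorems on each line. *)
Lemma is_derive_line f x v (s a : R) : is_derive (s *: v + x) v f a ->
  is_derive s (1 : R) (fun z : R => f (z *: v + x)) a.
Proof.
move=> [df Df].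
have E : (fun h : R => h^-1 *: (((fun z : R => f (z *: v + x)) \o shift s)
    (h *: (1 : R)) - f (s *: v + x))) =
   (fun h : R => h^-1 *: ((f \o shift (s *: v + x)) (h *: v) - f (s *: v + x))).
  by apply/funext => h /=; rewrite /GRing.scale /= mulr1 -/(GRing.scale _ _)
    addrA -scalerDl.
by apply: DeriveDef; [rewrite /derivable E|rewrite /derive E].
Qed.

Lemma partial_argmax0 f p i : (forall x, derivable f x (delta_mx i 0)) ->
  (forall x, f x <= f p) -> partial f i p = 0.
Proof.
move=> df fmax; set g := fun z : R => f (z *: delta_mx i 0 + p).
have dg s : is_derive s (1 : R) g (partial f i (s *: delta_mx i 0 + p)).
  by apply: is_derive_line; exact: DeriveDef.
have g0 : is_derive (0 : R) 1 g 0.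
  (* The maximum is global, so any open interval around 0 serves; (-1, 1) is an arbitrary choice. *)
  apply: (@derive1_at_max _ g (-1) 1 0).
  - lra.
  - by move=> t _; case: (dg t).
  - by rewrite in_itv /=; apply/andP; split; lra.
  - by move=> t _; rewrite /g scale0r add0r.
have := @derive_val _ _ _ _ _ _ _ (dg 0).
by rewrite scale0r add0r (@derive_val _ _ _ _ _ _ _ g0).
Qed.

(** One can walk from [y] to [x] one coordinate at a time: on each axis-parallel line the function
    has zero derivative, hence is constant. *)
Lemma partials0_cst f : (forall i x, is_derive x (delta_mx i 0) f 0) ->
  forall x y, f x = f y.
Proof.
move=> df x y.
have step (z : R) i w : f (z *: delta_mx i 0 + w) = f w.
  rewrite -[in RHS](add0r w) -[in RHS](scale0r (delta_mx i 0)).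
  apply: (@is_derive_0_is_cst _ (fun z : R => f (z *: delta_mx i 0 + w))) => s.
  by apply: is_derive_line; exact: df.
have -> : x = \sum_i (x - y) i 0 *: delta_mx i 0 + y.
  apply/colP => k; rewrite mxE summxE (bigD1 k) //= !mxE !eqxx mulr1.
  rewrite big1 ?addr0 ?subrK // => j /negPf jk.
  by rewrite !mxE eq_sym jk mulr0.
elim: (index_enum _) => [|i s IH]; first by rewrite big_nil add0r.
by rewrite big_cons -addrA step.
Qed.

(** The Hessian is integrated twice by [partials0_cst]: first to identify the gradient, whose
    constant is fixed by the critical point [p], then to identify [f] up to its value at [p]. *)
Lemma cst_hessian_quadratic f p (a : R) : cont_diff2 f ->
  (forall x, f x <= f p) -> (forall x, hessian f x = (- a)%:M) ->
  forall x, f p - f x = a / 2 * sqnorm (x - p).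
Proof.
move=> [f1 f2] fmax Hf x.
have df i y : is_derive y (delta_mx i 0) f (partial f i y).
  by apply: DeriveDef => //; exact: (f1 i).1.
have dq i y : is_derive y (delta_mx i 0)
    (fun z => a / 2 * sqnorm (z - p)) (a * (y - p) i 0).
  apply: (@is_derive_quadratic _ _ _ _ (a / 2)) => h.
  rewrite -!qform_scalar -[_ *: _ + _ - p]addrA.
  rewrite (qformD _ (_ *: _)) ?tr_scalar_mx //.
  rewrite qformZ qform_delta [(h *: _)^T]linearZ /= -scalemxAl.
  rewrite [(_ *: _ : 'M[_]_1) 0 0]mxE delta_mul_mx.
  by rewrite mul_scalar_mx [(_ *: _ : 'cV[_]__) i 0]mxE !mxE eqxx mulr1n; field.
(* First integration: [partial f i z + a * (z - p) i 0] has zero partials by the Hessian hypothesis,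
   and it vanishes at the maximiser [p]. *)
have Df i y : partial f i y = - a * (y - p) i 0.
  have := @partials0_cst (fun z => partial f i z + a * (z - p) i 0) _ y p.
  rewrite subrr [(0 : 'cV[_]__) i 0]mxE mulr0 addr0.
  rewrite (partial_argmax0 _ _ _ (f1 i).1 fmax).
  move=> H; apply/eqP; rewrite mulNr -addr_eq0; apply/eqP; apply: H => j z.
  have -> : (0 : R) = partial (partial f i) j z + a * (i == j)%:R.
    by move/(_ z)/matrixP: Hf => /(_ i j); rewrite !mxE => ->; ring.
  apply: is_deriveD; first by exact: (DeriveDef (((f2 i j).1) z) erefl).
  apply: (@is_derive_quadratic _ _ _ _ 0) => h.
  rewrite -[_ *: _ + _ - p]addrA [(_ *: _ + _ : 'cV[_]__) i 0]mxE.
  by rewrite [(_ *: _ : 'cV[_]__) i 0]mxE [delta_mx _ _ _ _]mxE andbT; ring.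
have := @partials0_cst (fun z => f z + a / 2 * sqnorm (z - p)) _ p x.
have -> : sqnorm (p - p) = 0 by rewrite subrr -[LHS]mul1r -qform_scalar qform0.
rewrite mulr0 addr0 => fpx.
suff -> : f p = f x + a / 2 * sqnorm (x - p) by rewrite addrC addKr.
apply: fpx => i y; have -> : (0 : R) = partial f i y + a * (y - p) i 0.
  by rewrite Df; ring.
exact: is_deriveD.
Qed.

End calculus_facts.

(** * Integrals of possibly infinite losses, and means of matrix-valued maps *)

Section integrals.
Context {R : realType} {disp : measure_display} {T : measurableType disp}.
Variable F : probability T R.

Definition mx_integrable {m n : nat} (B : set T) (X : T -> 'M[R]_(m, n)) :=
  forall i j, F.-integrable B (fun t => (X t i j)%:E).

Lemma bounded_by (f : T -> R) (B : set T) (M : R) :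
  (forall t, `|f t| <= M) -> [bounded f t | t in B].
Proof.
move=> fM; exists M; split; first exact: num_real.
by move=> y My t _; apply: le_trans (fM t) (ltW My).
Qed.

(* Neither [f] nor [g] is assumed integrable: both integrals may be [+oo]. *)
Lemma integral_add_centered (f g l : T -> R) :
  measurable_fun setT f -> measurable_fun setT g ->
  (forall t, 0 <= f t) -> (forall t, 0 <= g t) ->
  F.-integrable setT (EFin \o l) -> (\int[F]_t (l t)%:E = 0)%E ->
  (forall t, f t = g t + l t) ->
  (\int[F]_t (f t)%:E = \int[F]_t (g t)%:E)%E.
Proof.
(* The case of a finite integral on the right, stated for generic functions so that it applies in
   both directions. *)
have fin (u v w : T -> R) : measurable_fun setT v -> (forall t, 0 <= v t) ->
    F.-integrable setT (EFin \o w) -> (\int[F]_t (w t)%:E = 0)%E ->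
    (forall t, u t = v t + w t) -> (\int[F]_t (v t)%:E < +oo)%E ->
    (\int[F]_t (u t)%:E = \int[F]_t (v t)%:E)%E.
  move=> mv v0 iw w0 E voo.
  under eq_integral do rewrite E EFinD.
  rewrite integralD //; first by rewrite w0 adde0.
  apply/integrableP; split; first exact/measurable_EFinP.
  by under eq_integral do rewrite gee0_abs ?lee_fin ?v0 //.
move=> mf mg f0 g0 il l0 E.
have [goo|] := ltP (\int[F]_t (g t)%:E)%E +oo%E; first exact: (@fin f g l).
rewrite leye_eq => /eqP goo.
have [foo|] := ltP (\int[F]_t (f t)%:E)%E +oo%E; last first.
  by rewrite leye_eq goo => /eqP.
(* If only the integral of [f] were finite, then [g = f - l] would have the same finite integral:
   the roles are exchanged. *)
apply/esym/(@fin g f (fun t => - l t)) => //.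
- exact: (integrableN il).
- under eq_integral do rewrite EFinN.
  have -> : (\int[F]_t - (l t)%:E = (-1)%:E * \int[F]_t (l t)%:E)%E.
    by rewrite -integralZl //; apply: eq_integral => t _; rewrite mulN1e.
  by rewrite l0 mule0.
- by move=> t; rewrite E addrK.
Qed.

(** * Entrywise integrability and linearity of conditional means *)

Section matrix_means.
Context {B : set T} (mB : measurable B).

Lemma integrable_sumr (I : finType) (f : I -> T -> R) :
  (forall i, F.-integrable B (EFin \o f i)) ->
  F.-integrable B (fun t => (\sum_i f i t)%:E).
Proof.
move=> fi; under eq_fun do rewrite -sumEFin.
by apply: integrable_sum => // i _; exact: fi.
Qed.

Lemma Rintegral_sum (I : finType) (f : I -> T -> R) :
  (forall i, F.-integrable B (EFin \o f i)) ->
  \int[F]_(t in B) (\sum_i f i t) = \sum_i \int[F]_(t in B) f i t.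
Proof.
move=> fi; rewrite /Rintegral; under eq_integral do rewrite -sumEFin.
rewrite (integral_sum mB fi); apply: EFin_inj; rewrite -sumEFin fineK.
  by apply: eq_bigr => i _; rewrite (fineK (integrable_fin_num mB (fi i))).
apply/sum_fin_numP => i _ _; exact: (integrable_fin_num mB (fi i)).
Qed.

(** A bounded measurable weight keeps integrability, so weighted means exist although [X] is only
    integrable, not square integrable. *)
Lemma mx_integrable_bounded_mulmx (l m n : nat) (W : T -> 'M[R]_(l, m))
    (X : T -> 'M[R]_(m, n)) (M : R) :
  (forall i j, measurable_fun setT (fun t => W t i j)) ->
  (forall t i j, `|W t i j| <= M) ->
  mx_integrable B X -> mx_integrable B (fun t => W t *m X t).
Proof.
move=> mW WM iX i j; under eq_fun do rewrite mxE; apply: integrable_sumr => k.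
apply: (integrableMr mB _ _ (iX k j)); last exact: bounded_by (WM ^~ i ^~ k).
exact: measurable_funS (mW i k).
Qed.

Lemma mx_integrable_cst (m n : nat) (A : 'M[R]_(m, n)) :
  mx_integrable B (fun=> A).
Proof. by move=> i j; exact: finite_measure_integrable_cst. Qed.

Lemma mx_integrableB (m n : nat) (X Y : T -> 'M[R]_(m, n)) :
  mx_integrable B X -> mx_integrable B Y ->
  mx_integrable B (fun t => X t - Y t).
Proof.
move=> iX iY i j; under eq_fun do rewrite !mxE EFinB.
exact: integrableB.
Qed.

Lemma mx_integrable_mulmxl (l m n : nat) (A : 'M[R]_(l, m))
    (X : T -> 'M[R]_(m, n)) :
  mx_integrable B X -> mx_integrable B (fun t => A *m X t).
Proof.
move=> iX i j; under eq_fun do rewrite mxE; apply: integrable_sumr => k.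
exact: (integrableZl mB _ (iX k j)).
Qed.

Lemma mx_integrable_mulmxr (l m n : nat) (X : T -> 'M[R]_(l, m))
    (A : 'M[R]_(m, n)) :
  mx_integrable B X -> mx_integrable B (fun t => X t *m A).
Proof.
move=> iX i j; under eq_fun do rewrite mxE; apply: integrable_sumr => k.
exact: (integrableZr mB _ (iX i k)).
Qed.

Lemma cond_meanB (m n : nat) (X Y : T -> 'M[R]_(m, n)) :
  mx_integrable B X -> mx_integrable B Y ->
  cond_mean F (fun t => X t - Y t) B = cond_mean F X B - cond_mean F Y B.
Proof.
move=> iX iY; apply/matrixP => i j; rewrite !mxE -mulrBl; congr (_ / _).
rewrite -(RintegralB mB (iX i j) (iY i j)).
by apply: eq_Rintegral => t _; rewrite !mxE.
Qed.

Lemma cond_mean_mulmxl (l m n : nat) (A : 'M[R]_(l, m))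
    (X : T -> 'M[R]_(m, n)) :
  mx_integrable B X -> cond_mean F (fun t => A *m X t) B = A *m cond_mean F X B.
Proof.
move=> iX; apply/matrixP => i j; rewrite !mxE.
under [RHS]eq_bigr do rewrite mxE mulrA.
rewrite -mulr_suml; congr (_ / _).
under eq_Rintegral do rewrite mxE.
rewrite Rintegral_sum; last by move=> k; exact: (integrableZl mB _ (iX k j)).
by apply: eq_bigr => k _; rewrite RintegralZl //; exact: iX.
Qed.

Lemma cond_mean_mulmxr (l m n : nat) (X : T -> 'M[R]_(l, m))
    (A : 'M[R]_(m, n)) :
  mx_integrable B X -> cond_mean F (fun t => X t *m A) B = cond_mean F X B *m A.
Proof.
move=> iX; apply/matrixP => i j; rewrite !mxE.
under [RHS]eq_bigr do rewrite mxE mulrAC.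
rewrite -mulr_suml; congr (_ / _).
under eq_Rintegral do rewrite mxE.
rewrite Rintegral_sum; last by move=> k; exact: (integrableZr mB _ (iX i k)).
by apply: eq_bigr => k _; rewrite RintegralZr //; exact: iX.
Qed.

Lemma fine_prob_gt0 : (0 < F B)%E -> 0 < fine (F B).
Proof.
by move=> FB; rewrite fine_gt0 // FB ltey_eq fin_num_measure.
Qed.

Lemma cond_mean_cst (m n : nat) (A : 'M[R]_(m, n)) : (0 < F B)%E ->
  cond_mean F (fun=> A) B = A.
Proof.
move=> /fine_prob_gt0 FB; apply/matrixP => i j; rewrite mxE Rintegral_cst //.
by rewrite mulfK // gt_eqF.
Qed.

Lemma qform_cond_mean (n : nat) (W : T -> 'M[R]_n) (v : 'cV[R]_n) :
  mx_integrable B W ->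
  qform (cond_mean F W B) v = (\int[F]_(t in B) qform (W t) v) / fine (F B).
Proof.
move=> iW; rewrite /qform -cond_mean_mulmxl // -cond_mean_mulmxr ?mxE //.
exact: mx_integrable_mulmxl.
Qed.

(** The form is linear in its matrix, so at the mean weight it is the average of the forms, and a
    uniform lower bound survives averaging. This yields invertibility of the mean weight in (d). *)
Lemma qform_cond_mean_ge (n : nat) (W : T -> 'M[R]_n) (v : 'cV[R]_n) (a : R) :
  (0 < F B)%E -> mx_integrable B W ->
  (forall t, a * sqnorm v <= qform (W t) v) ->
  a * sqnorm v <= qform (cond_mean F W B) v.
Proof.
move=> /fine_prob_gt0 FB iW aW; rewrite qform_cond_mean // ler_pdivlMr //.
rewrite -Rintegral_cst //; apply: le_Rintegral => //.
  exact: finite_measure_integrable_cst.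
have ivW := mx_integrable_mulmxl _ _ _ v^T _ iW.
exact: (mx_integrable_mulmxr _ _ _ _ _ ivW 0 0).
Qed.

(* [cond_mean] is a junk value when [F B = 0], but then the integral vanishes
   anyway. *)
Lemma integral0_of_cond_mean0 (m n : nat) (X : T -> 'M[R]_(m, n)) :
  mx_integrable B X -> ((0 < F B)%E -> cond_mean F X B = 0) ->
  forall i j, (\int[F]_(t in B) (X t i j)%:E = 0)%E.
Proof.
move=> iX X0 i j; have [FB0|FB0] := eqVneq (F B) 0%E.
  by apply: null_set_integral => //; exact: (measurable_int F (iX i j)).
have FB : (0 < F B)%E by rewrite lt0e FB0 measure_ge0.
have /matrixP/(_ i j) := X0 FB; rewrite !mxE => /eqP.
rewrite mulf_eq0 invr_eq0 [X in _ || X]gt_eqF ?fine_prob_gt0 // orbF => /eqP.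
rewrite /Rintegral => XB0.
by rewrite -(fineK (integrable_fin_num mB (iX i j))) XB0.
Qed.

End matrix_means.

(** * Weighted quadratic losses and their minimisers under the normal equations *)

Section quadratic_loss.
Context {r K : nat} (c : T -> 'I_K) (x : T -> 'cV[R]_r).
Hypothesis c_meas : forall k, measurable (cell c k).
Hypothesis x_int : mx_integrable setT x.

Lemma measurable_fun_cell (a : 'I_K -> R) :
  measurable_fun setT (fun t => a (c t)).
Proof.
move=> _ A mA; rewrite setTI.
rewrite (_ : _ @^-1` _ = \bigcup_(k in [set k | A (a k)]) cell c k).
  exact: fin_bigcup_measurable.
apply/seteqP; split => t /=; first by move=> Aat; exists (c t).
by move=> [k /= Aak ->].
Qed.

Lemma cell_fun_bounded (a : 'I_K -> R) t : `|a (c t)| <= \sum_k `|a k|.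
Proof. by rewrite (bigD1 (c t)) //= lerDl sumr_ge0. Qed.

Lemma mx_integrable_cell_fun (g : 'I_K -> 'cV[R]_r) :
  mx_integrable setT (fun t => g (c t)).
Proof.
move=> i j; apply: measurable_bounded_integrable => //.
- by rewrite ltey_eq fin_num_measure.
- exact: (measurable_fun_cell (fun k => g k i j)).
- exact: bounded_by (cell_fun_bounded (fun k => g k i j)).
Qed.

Lemma integral_cells (f : T -> R) : measurable_fun setT f ->
  (\int[F]_t (f t)%:E = \sum_k \int[F]_(t in cell c k) (f t)%:E)%E.
Proof.
move=> mf.
have cov : setT = \big[setU/set0]_k cell c k.
  apply/seteqP; split => // t _; rewrite -bigcup_seq.
  by exists (c t) => //=; exact: mem_index_enum.
rewrite cov integral_bigsetU_EFin //.
- exact: index_enum_uniq.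
- exact: trivIset_preimage1.
- by rewrite -cov; exact/measurable_EFinP.
Qed.

Lemma measurable_qform (W : T -> 'M[R]_r) (v : T -> 'cV[R]_r) :
  (forall i j, measurable_fun setT (fun t => W t i j)) ->
  (forall i, measurable_fun setT (fun t => v t i 0)) ->
  measurable_fun setT (fun t => qform (W t) (v t)).
Proof.
move=> mW mv; rewrite /qform; under eq_fun do rewrite mxE.
apply: measurable_sum => j; apply: measurable_funM => //.
under eq_fun do rewrite mxE; apply: measurable_sum => i.
by under eq_fun do rewrite mxE; exact: measurable_funM.
Qed.

Definition quad_loss (W : T -> 'M[R]_r) (g : 'I_K -> 'cV[R]_r) : \bar R :=
  (\int[F]_t (qform (W t) (g (c t) - x t))%:E)%E.

Context (W : T -> 'M[R]_r) (M : R) (p : 'I_K -> 'cV[R]_r).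
Hypothesis W_meas : forall i j, measurable_fun setT (fun t => W t i j).
Hypothesis W_bounded : forall t i j, `|W t i j| <= M.
Hypothesis W_psd : forall t, psdmx (W t).

Lemma measurable_cell_sub (g : 'I_K -> 'cV[R]_r) i :
  measurable_fun setT (fun t => (g (c t) - x t) i 0).
Proof.
apply/measurable_EFinP; apply: (measurable_int F).
have ig := mx_integrable_cell_fun g.
exact: (mx_integrableB measurableT _ _ _ _ ig x_int i 0).
Qed.

(** Cells of probability zero are excluded, since [cond_mean] carries no information there. *)
Hypothesis normal_eq : forall k, (0 < F (cell c k))%E ->
  cond_mean F (fun t => W t *m (x t - p k)) (cell c k) = 0.

Lemma quad_loss_pythagoras (g : 'I_K -> 'cV[R]_r) :
  quad_loss W g = (quad_loss W p +
    \int[F]_t (qform (W t) (g (c t) - p (c t)))%:E)%E.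
Proof.
have mp := measurable_qform _ _ W_meas (measurable_cell_sub p).
have mgp : measurable_fun setT (fun t => qform (W t) (g (c t) - p (c t))).
  by apply: measurable_qform => // i;
    exact: (measurable_fun_cell (fun k => (g k - p k) i 0)).
have pos t v : 0 <= qform (W t) v by have [] := W_psd t.
rewrite /quad_loss -ge0_integralD //; try exact/measurable_EFinP;
  try by move=> t _; rewrite lee_fin.
under [RHS]eq_integral do rewrite -EFinD.
set y := fun t => W t *m (x t - p (c t)).
have iy : mx_integrable setT y.
  apply: mx_integrable_bounded_mulmx W_meas W_bounded _ => //.
  exact: mx_integrableB x_int (mx_integrable_cell_fun p).
(* The cross term of the expansion. Its coefficients take finitely many values, hence are bounded,
   and [y] is integrable, so [l] is integrable. *)
pose l t := \sum_i (- 2 * (g (c t) - p (c t)) i 0) * y t i 0.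
have il : F.-integrable setT (EFin \o l).
  apply: integrable_sumr => // i; apply: (integrableMr _ _ _ (iy i 0)) => //.
    exact: (measurable_fun_cell (fun k => - 2 * (g k - p k) i 0)).
  exact: bounded_by (cell_fun_bounded (fun k => - 2 * (g k - p k) i 0)).
apply: (@integral_add_centered _ _ l) => //.
- exact: measurable_qform W_meas (measurable_cell_sub g).
- exact: measurable_funD.
- by move=> t; rewrite addr_ge0.
(* On a single cell the coefficients are constants and leave the integral; what remains vanishes by
   [normal_eq]. *)
- rewrite integral_cells; last exact/measurable_EFinP/(measurable_int F il).
  apply: big1 => k _.
  have ik : mx_integrable (cell c k) (fun t => W t *m (x t - p k)).
    apply: mx_integrable_bounded_mulmx W_meas W_bounded _ => //.
    apply: mx_integrableB => //; last exact: mx_integrable_cst.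
    by move=> i j; apply: integrableS (x_int i j).
  under eq_integral => t /set_mem /= ct.
    rewrite /l /y ct -sumEFin; over.
  rewrite integral_sum //; last by move=> i; exact: (integrableZl _ _ (ik i 0)).
  apply: big1 => i _; under eq_integral do rewrite EFinM.
  rewrite integralZl //.
  by rewrite (integral0_of_cond_mean0 (c_meas k) _ _ _ ik (normal_eq k)) mule0.
- move=> t; have -> : g (c t) - x t = (g (c t) - p (c t)) + - (x t - p (c t)).
    by rewrite opprB addrA subrK.
  rewrite qformD; last by have [] := W_psd t.
  rewrite -(opprB (x t)) [X in X + _]addrC !qformN; congr (_ + _).
  rewrite mulmxN mulmxN mxE mxE mulrN -mulNr mulr_sumr /l.
  by apply: eq_bigr => i _; rewrite mulrA mxE.
Qed.

Lemma quad_loss_min (g : 'I_K -> 'cV[R]_r) : (quad_loss W p <= quad_loss W g)%E.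
Proof.
rewrite (quad_loss_pythagoras g) leeDl //; apply: integral_ge0 => t _.
by rewrite lee_fin; have [_] := W_psd t; apply.
Qed.

(** Finiteness of the loss of [p] allows it to be cancelled in the Pythagorean identity. The excess
    integral is then at most zero, yet it dominates [a * sqnorm (g k - p k)] times the probability
    of cell [k]. *)
Lemma quad_loss_argmin_unique (a : R) (g : 'I_K -> 'cV[R]_r) : 0 < a ->
  (forall t v, a * sqnorm v <= qform (W t) v) ->
  (quad_loss W p < +oo)%E -> (quad_loss W g <= quad_loss W p)%E ->
  forall k, (0 < F (cell c k))%E -> g k = p k.
Proof.
move=> a0 aW poo gp k Fk; apply/eqP; rewrite -subr_eq0; apply/eqP/sqnorm_eq0.
have pos t v : 0 <= qform (W t) v by have [] := W_psd t.
have pfin : quad_loss W p \is a fin_num.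
  by rewrite ge0_fin_numE //; apply: integral_ge0 => t _; rewrite lee_fin.
have : (\int[F]_t (qform (W t) (g (c t) - p (c t)))%:E <= 0)%E.
  by rewrite -(@leeD2lE _ (quad_loss W p)) // adde0 -quad_loss_pythagoras.
have mgp : measurable_fun setT (fun t => qform (W t) (g (c t) - p (c t))).
  by apply: measurable_qform => // i;
    exact: (measurable_fun_cell (fun k => (g k - p k) i 0)).
move=> int0; apply/eqP; rewrite eq_le sqnorm_ge0 andbT.
rewrite -(pmulr_rle0 _ a0) -lee_fin -(pmule_lle0 _ Fk) -integral_cst //.
apply: le_trans int0; apply: le_trans (ge0_subset_integral _ _ _ _ _ _) => //.
- apply: ge0_le_integral => //.
  + by move=> t _; rewrite lee_fin mulr_ge0 ?sqnorm_ge0 // ltW.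
  + exact/measurable_EFinP/measurable_funTS.
  + by move=> t <-; rewrite lee_fin.
- exact/measurable_EFinP.
- by move=> t _; rewrite lee_fin.
Qed.

End quadratic_loss.
End integrals.

(** * Decoding error and welfare loss as weighted quadratic losses *)

Section losses.
Context {R : realType} {disp : measure_display} {T : measurableType disp}.
Context (F : probability T R) {r K : nat}.
Context (c : T -> 'I_K) (x : T -> 'cV[R]_r).

Lemma decoding_errorE (g : 'I_K -> 'cV[R]_r) :
  decoding_error F x c g = quad_loss F c x (fun=> 1%:M) g.
Proof.
rewrite /decoding_error unlock; apply: eq_integral => t _.
by rewrite qform_scalar mul1r -sqnormN opprB.
Qed.

Hypothesis c_meas : forall k, measurable (cell c k).
Hypothesis x_int : mx_integrable F setT x.

(** Nonnegativity lets the factor [a] leave the integral even at infinite loss. Part (b) takes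
    [W = I] and [a = alpha / 2]; (c) and (d) take [a = 1 / 2]. *)
Lemma welfare_lossE (U : T -> 'cV[R]_r -> R) (W : T -> 'M[R]_r) (a : R)
    (g : 'I_K -> 'cV[R]_r) :
  (forall i j, measurable_fun setT (fun t => W t i j)) ->
  (forall t, psdmx (W t)) -> 0 <= a ->
  (forall t y, U t (x t) - U t y = a * qform (W t) (y - x t)) ->
  welfare_loss F U x c g = (a%:E * quad_loss F c x W g)%E.
Proof.
move=> mW W0 a0 UE; rewrite /welfare_loss unlock /quad_loss.
rewrite -ge0_integralZl_EFin //.
- by apply: eq_integral => t _; rewrite UE EFinM.
- by move=> t _; rewrite lee_fin; have [_] := W0 t; apply.
- apply/measurable_EFinP; apply: measurable_qform mW _ => i.
  exact: (measurable_cell_sub F _ _ c_meas x_int).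
Qed.

(** A constant weight factors out of the conditional mean, so the ordinary mean solves the normal
    equations of every constant weight at once; this settles (a) and (c). *)
Lemma normal_eq_cst (A : 'M[R]_r) (p : 'cV[R]_r) (B : set T) : measurable B ->
  (0 < F B)%E -> p = cond_mean F x B ->
  cond_mean F (fun t => A *m (x t - p)) B = 0.
Proof.
move=> mB FB pE.
have ix : mx_integrable F B x by move=> i j; apply: integrableS (x_int i j).
have ip : mx_integrable F B (fun=> p) by exact: mx_integrable_cst.
rewrite cond_mean_mulmxl //; last exact: mx_integrableB.
by rewrite cond_meanB // cond_mean_cst // -pE subrr mulmx0.
Qed.

(** The normal equation is linear in [p], namely E[W x | B] = E[W | B] p, and is solved by inverting
    the mean weight. *)
Lemma normal_eq_weighted (W : T -> 'M[R]_r) (M : R) (p : 'cV[R]_r)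
    (B : set T) : measurable B ->
  (forall i j, measurable_fun setT (fun t => W t i j)) ->
  (forall t i j, `|W t i j| <= M) ->
  cond_mean F W B \in unitmx ->
  p = invmx (cond_mean F W B) *m cond_mean F (fun t => W t *m x t) B ->
  cond_mean F (fun t => W t *m (x t - p)) B = 0.
Proof.
move=> mB mW WM WU pE.
have ix : mx_integrable F B x by move=> i j; apply: integrableS (x_int i j).
have iW : mx_integrable F B W.
  move=> i j; apply: measurable_bounded_integrable => //.
  - by rewrite ltey_eq fin_num_measure.
  - exact: measurable_funTS.
  - exact: bounded_by.
have -> : (fun t => W t *m (x t - p)) = (fun t => W t *m x t - W t *m p).
  by apply/funext => t; rewrite mulmxBr.
rewrite cond_meanB // ?cond_mean_mulmxr //.
- by rewrite pE mulKVmx // subrr.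
- exact: mx_integrable_bounded_mulmx mW WM ix.
- exact: mx_integrable_mulmxr.
Qed.

End losses.

Theorem proposition2 (R : realType) (d r K : nat)
    (TT : set (d.-tuple R)) (t0 : TT)
    (F : probability (trace_space t0) R)
    (U : trace_space t0 -> 'cV[R]_r -> R)
    (alpha betaU : R)
    (phistar : trace_space t0 -> 'cV[R]_r)
    (c : trace_space t0 -> 'I_K)
    (phi : 'I_K -> 'cV[R]_r)
    (U_meas : measurable_fun setT
       (fun p : trace_space t0 * r.-tuple R => U p.1 (col_of_tuple p.2)))
    (U_C2 : forall t, cont_diff2 (U t))
    (alpha_gt0 : 0 < alpha) (alpha_le : alpha <= betaU)
    (A1 : forall t x, loewner_le (- betaU)%:M (hessian (U t) x))
    (A2 : forall t x, loewner_le (hessian (U t) x) (- alpha)%:M)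
    (phistar_argmax : forall t x, U t x <= U t (phistar t))
    (phistar_int : forall i,
       F.-integrable setT (fun t => (phistar t i 0)%:E))
    (c_meas : forall k, measurable (cell c k))
    (phiE : forall k, (0 < F (cell c k))%E ->
       phi k = cond_mean F phistar (cell c k)) :
  [/\ (* (a) *)
      minimises (decoding_error F phistar c) phi,
      (* (b) *)
      ((forall t x, loewner_le (- alpha)%:M (hessian (U t) x)) <->
       (forall t x, hessian (U t) x = (- alpha)%:M)) /\
      (alpha = betaU ->
       [/\ minimises (welfare_loss F U phistar c) phi,
           ((alpha / 2)%:E * decoding_error F phistar c phi =
            welfare_loss F U phistar c phi)%E &
           (welfare_loss F U phistar c phi =
            (betaU / 2)%:E * decoding_error F phistar c phi)%E]),
      (* (c) *)
      (forall W : 'M[R]_r, posdefmx W ->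
         (forall t x, U t x = - (1 / 2) * qform W (x - phistar t)) ->
       minimises (welfare_loss F U phistar c) phi) &
      (* (d) *)
      (forall (W : trace_space t0 -> 'M[R]_r) (phiW : 'I_K -> 'cV[R]_r),
         (forall i j, measurable_fun setT (fun t => W t i j)) ->
         (forall t, posdefmx (W t)) ->
         (forall t x, U t x = - (1 / 2) * qform (W t) (x - phistar t)) ->
         (forall k, (0 < F (cell c k))%E ->
            phiW k = invmx (cond_mean F W (cell c k)) *m
                     cond_mean F (fun t => W t *m phistar t) (cell c k)) ->
       [/\ (forall k, (0 < F (cell c k))%E ->
              cond_mean F W (cell c k) \in unitmx),
           minimises (welfare_loss F U phistar c) phiW,
           ((welfare_loss F U phistar c phiW < +oo)%E ->
            forall g, minimises (welfare_loss F U phistar c) g ->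
            forall k, (0 < F (cell c k))%E -> g k = phiW k) &
           minimises (decoding_error F phistar c) phi])].
Proof.
have x_int : mx_integrable F setT phistar.
  by move=> i j; rewrite (ord1 j); exact: phistar_int.
(* A crude common bound on the entries of a constant weight, as required by the Pythagorean
   identity. *)
have bnd_cst (W : 'M[R]_r) i j : `|W i j| <= \sum_i \sum_j `|W i j|.
  rewrite (bigD1 i) //= (bigD1 j) //= -addrA lerDl addr_ge0 ?sumr_ge0 // => k _.
  exact: sumr_ge0.
have min_cst (W : 'M[R]_r) g : psdmx W ->
    (quad_loss F c phistar (fun=> W) phi <=
     quad_loss F c phistar (fun=> W) g)%E.
  move=> W0.
  apply: (quad_loss_min _ _ _ c_meas x_int _ _ _ _ (fun=> bnd_cst W)) => //.
  by move=> k Fk; apply: normal_eq_cst => //; exact: phiE.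
have psd1 : psdmx (1%:M : 'M[R]_r).
  split; first exact: tr_scalar_mx.
  by move=> v; rewrite qform_scalar mul1r sqnorm_ge0.
have min_error : minimises (decoding_error F phistar c) phi.
  by move=> g; rewrite !decoding_errorE; exact: min_cst.
have UdiffE t (W : 'M[R]_r) :
    (forall x, U t x = - (1 / 2) * qform W (x - phistar t)) ->
    forall x, U t (phistar t) - U t x = 1 / 2 * qform W (x - phistar t).
  by move=> UE x; rewrite !UE subrr qform0; ring.
have half_ge0 : 0 <= 1 / 2 :> R by rewrite divr_ge0.
split => //.
(* Antisymmetry of the Loewner order: together with A2 the form of the difference vanishes. With
   [alpha = betaU], A1 supplies the premise. *)
- have hessE : (forall t x, loewner_le (- alpha)%:M (hessian (U t) x)) ->
      forall t x, hessian (U t) x = (- alpha)%:M.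
    move=> lo t x; apply/eqP; rewrite -subr_eq0; apply/eqP/qform_eq0.
      by have [] := lo t x.
    move=> v; apply/eqP; rewrite eq_le; have [_ ->] := lo t x.
    have [_ /(_ v)] := A2 t x; rewrite !qformBl => ?; rewrite andbT; lra.
  split.
    split=> // H t x; rewrite H /loewner_le subrr; split; first exact: trmx0.
    by move=> v; rewrite /qform mulmx0 mul0mx mxE.
  move=> ab; have Hess : forall t x, hessian (U t) x = (- alpha)%:M.
    by apply: hessE; rewrite ab.
  have lossE g : welfare_loss F U phistar c g =
      ((alpha / 2)%:E * decoding_error F phistar c g)%E.
    rewrite decoding_errorE; apply: welfare_lossE => //.
    - by rewrite divr_ge0 // ltW.
    - move=> t x; rewrite qform_scalar mul1r.
      exact: cst_hessian_quadratic.
  split; [|by rewrite lossE|by rewrite lossE -ab].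
  move=> g; rewrite !lossE; apply: lee_wpmul2l (min_error g).
  by rewrite lee_fin divr_ge0 // ltW.
- move=> W /posdef_psdmx W0 UE g.
  rewrite !(@welfare_lossE _ _ _ _ _ _ _ _ c_meas x_int U (fun=> W) (1 / 2)) //;
    try by move=> t x; apply: UdiffE; exact: UE.
  by rewrite lee_wpmul2l ?lee_fin //; exact: min_cst.
- move=> W phiW mW /(_ _)/posdef_psdmx W0 UE phiWE.
  have hessW t x : hessian (U t) x = - W t.
    have -> : U t = fun y => - (1 / 2) * qform (W t) (y - phistar t).
      by apply/funext => y.
    by apply: hessian_quadratic; have [] := W0 t.
  have Wlo t v : alpha * sqnorm v <= qform (W t) v.
    have [_ /(_ v)] := A2 t 0.
    by rewrite hessW qformBl qformNl qform_scalar; lra.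
  have Whi t v : qform (W t) v <= betaU * sqnorm v.
    have [_ /(_ v)] := A1 t 0.
    by rewrite hessW qformBl qformNl qform_scalar; lra.
  (* The upper form bound at basis vectors controls the diagonal, and semidefiniteness extends this
     to all entries. *)
  have WM t i j : `|W t i j| <= betaU.
    apply: psdmx_entry_le => // k; rewrite -qform_delta (le_trans (Whi _ _)) //.
    by rewrite -qform_scalar qform_delta mxE eqxx.
  have WU k : (0 < F (cell c k))%E -> cond_mean F W (cell c k) \in unitmx.
    move=> Fk; apply: posdef_unitmx => v v0.
    apply: lt_le_trans (qform_cond_mean_ge _ _ _ _ _ _ _ _ (Wlo^~ v)) => //.
      rewrite mulr_gt0 // lt0r sqnorm_ge0 andbT.
      by apply: contra v0 => /eqP/sqnorm_eq0 ->.
    move=> i j; apply: measurable_bounded_integrable => //.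
    - by rewrite ltey_eq fin_num_measure.
    - exact: measurable_funTS.
    - by apply: bounded_by => t; exact: WM.
  have neq k : (0 < F (cell c k))%E ->
      cond_mean F (fun t => W t *m (phistar t - phiW k)) (cell c k) = 0.
    move=> Fk; apply: (@normal_eq_weighted _ _ _ _ _ _ x_int _ betaU) => //.
      exact: WU.
    exact: phiWE.
  have lossE g : welfare_loss F U phistar c g =
      ((1 / 2)%:E * quad_loss F c phistar W g)%E.
    by apply: welfare_lossE => // t x; apply: UdiffE; exact: UE.
  have half0 : (0 < (1 / 2)%:E :> \bar R)%E by rewrite lte_fin divr_gt0.
  split => //.
  + move=> g; rewrite !lossE lee_wpmul2l ?lee_fin //.
    exact: (quad_loss_min _ _ _ c_meas x_int _ _ _ mW WM).
  + move=> phiWoo g /(_ phiW); rewrite !lossE lee_pmul2l // => gmin.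
    apply: (quad_loss_argmin_unique _ _ _ c_meas x_int _ _ _ mW WM W0 neq
      alpha) => //.
    (* By contraposition: an infinite quadratic loss times the positive factor 1/2 would make the
       welfare loss infinite. *)
    move: phiWoo; rewrite lossE; apply: contraTT; rewrite -!leNgt leye_eq.
    by move=> /eqP ->; rewrite gt0_muley.
Qed.
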